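(* Let $\mu,\sigma,X,T,G,V,\mathcal{C},\mathcal{D},\mathbb{L}_X$ be as in the context, where the gain function $G:\mathbb{R}\to\mathbb{R}$ is time independent. Assume: (i) $\mu$ and $\sigma$ are locally Lipschitz, $\mu$ is piecewise-$C^2$, $\sigma>0$ and $\sigma$ is piecewise-$C^3$; (ii) $G$ is upper semi-continuous; (iii) the value function $V(t,x):=\sup_{0\le\tau\le T-t}\mathsf{E}_x[G(X_\tau)]$ is continuous on $(0,T)\times\mathbb{R}$; (iv) there exists a free-boundary $\{b(t),\,0\le t\le T\}$ such that $\mathcal{C}=\{(t,x): t\in[0,T),\ x>b(t)\}$ and $\mathcal{D}=\{(t,x): t\in[0,T),\ x\le b(t)\}\cup(\{T\}\times\mathbb{R})$; (v) for any $t\in[0,T)$ there exist $\varepsilon>0$ and a ball $\mathcal{B}:=\mathcal{B}^{\varepsilon}_{t,b(t)}$ centered at $(t,b(t))$ with radius $\varepsilon$ such that $G$, viewed as a function of $(t,x)$, belongs to $C^{1,2}(\overline{\mathcal{B}\cap\mathcal{C}})$; (vi) there exist $\varepsilon>0$ and $\mathcal{B}$ as in (v) (for each $t\in[0,T)$) and a constant $\ell_\varepsilon>0$ such that $G_t+\mathbb{L}_XG=\mathbb{L}_XG\le-\ell_\varepsilon$ in $\overline{\mathcal{B}\cap\mathcal{C}}$. Then $t\mapsto b(t)$ is increasing and continuous on $[0,T]$.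
   Context: Let $(\Omega,\mathcal{F},\mathsf{P})$ be a complete probability space with the natural filtration $\mathbb{F}=(\mathcal{F}_t)_{t\ge0}$ (completed with $\mathsf{P}$-null sets) of a one dimensional standard Brownian motion $B$. For $\mu:\mathbb{R}\to\mathbb{R}$ and $\sigma:\mathbb{R}\to\mathbb{R}_+$, $X=(X_t)_{t\ge0}$ is the real process that uniquely solves, in the strong sense, $dX_t=\mu(X_t)dt+\sigma(X_t)dB_t$, $X_0=x$. $\mathsf{P}_x$ is the probability measure induced by $X$ started at time zero from $x$, with expectation $\mathsf{E}_x$. Its infinitesimal generator is $\mathbb{L}_Xf(x)=\frac{\sigma^2(x)}{2}f''(x)+\mu(x)f'(x)$. Fix $0<T<\infty$ and $G:\mathbb{R}\to\mathbb{R}$ (the gain function). The supremum defining $V(t,x)$ is over all $\mathbb{F}$-stopping times in $[0,T-t]$. The continuation set is $\mathcal{C}:=\{(t,x)\in[0,T]\times\mathbb{R}: V(t,x)>G(x)\}$ and the stopping set is $\mathcal{D}:=\{(t,x)\in[0,T]\times\mathbb{R}: V(t,x)=G(x)\}$. Standing assumptions: the stopping time $\tau_*(t,x):=\inf\{s\ge0: V(t+s,X_s)=G(X_s)\}\wedge(T-t)$ under $\mathsf{P}_x$ is optimal for $V(t,x)$; $\mathcal{C}$ is open and $\mathcal{D}$ is closed in $[0,T]\times\mathbb{R}$. By standard Markovian arguments $V\in C^{1,2}$ inside $\mathcal{C}$ and $V_t+\mathbb{L}_XV=0$ in $\mathcal{C}$. ''Increasing'' means $b(s)\le b(t)$ whenever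 $s\le t$.
   Formalization: Since C and D do not determine b(T), the value b(T) is taken to be the left limit b(T-), possibly infinite, and monotonicity and continuity on [0,T] are proved for b with this value at T; with an arbitrary b(T) the claim fails. *)

(* Defs.v *)
From HB Require Import structures.
From mathcomp Require Export all_boot all_order all_algebra.
From mathcomp Require Export all_classical all_reals all_analysis.
Export Order.TTheory GRing.Theory Num.Theory.
Export numFieldNormedType.Exports.

Set Implicit Arguments.
Unset Strict Implicit.
Unset Printing Implicit Defensive.

Local Open Scope classical_set_scope.
Local Open Scope ring_scope.

(* Time is a real variable; only nonnegative times are meaningful. *)

Definition measurable_wrt (T : Type) (R : realType) (F : set (set T))
    (Y : T -> R) :=
  forall U : set R, measurable U -> F (Y @^-1` U).

Definition completed_natural_filtration (d : measure_display)
    (T : measurableType d) (R : realType) (P : probability T R)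
    (B : R -> T -> R) (t : R) : set (set T) :=
  <<s [set A | (exists s (U : set R),
                  [/\ 0 <= s <= t, measurable U & A = B s @^-1` U])
               \/ P.-negligible A] >>.

Definition increment (T : Type) (R : realType) (B : R -> T -> R) (s t : R)
    (w : T) : R := B t w - B s w.

Definition brownian_motion (d : measure_display) (T : measurableType d)
    (R : realType) (P : probability T R) (B : R -> T -> R) :=
  [/\ forall t : R, 0 <= t -> measurable_fun setT (B t),
      {ae P, forall w, B 0 w = 0},
      {ae P, forall w, {within `[0, +oo[, continuous (fun t => B t w)}},
      forall (s t : R) (U : set R), 0 <= s < t -> measurable U ->
        P (increment B s t @^-1` U) = normal_prob 0 (Num.sqrt (t - s)) U
    & forall (s t : R) (A : set T) (U : set R), 0 <= s < t ->
        completed_natural_filtration P B s A -> measurable U ->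
        P (A `&` increment B s t @^-1` U)
        = (P A * P (increment B s t @^-1` U))%E].

(* The step process with value [coeff H i] on [[node H i, node H i.+1[]
   for [i < steps H]. *)
Record step_process (T : Type) (R : realType) := StepProcess {
  steps : nat;
  node : nat -> R;
  coeff : nat -> T -> R }.

Definition adapted_step (T : Type) (R : realType) (F : R -> set (set T))
    (t : R) (H : step_process T R) :=
  [/\ node H 0 = 0, node H (steps H) = t,
      forall i, (i < steps H)%N -> node H i <= node H i.+1
    & forall i, (i < steps H)%N -> measurable_wrt (F (node H i)) (coeff H i)].

Definition step_value (T : Type) (R : realType) (H : step_process T R)
    (s : R) (w : T) : R :=
  \sum_(i < steps H) coeff H i w * \1_(`[node H i, node H i.+1[ : set R) s.

Definition step_integral (T : Type) (R : realType) (B : R -> T -> R)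
    (H : step_process T R) (w : T) : R :=
  \sum_(i < steps H) coeff H i w * increment B (node H i) (node H i.+1) w.

Definition cvg_in_probability0 (d : measure_display) (T : measurableType d)
    (R : realType) (P : probability T R) (Z : nat -> T -> \bar R) :=
  forall e : R, 0 < e -> P [set w | (e%:E < Z n w)%E] @[n --> \oo] --> 0%E.

(* [I] is the Ito integral of [H] against [B] over [0, t]: the limit in
   probability of the integrals of adapted step processes [S n] such that
   \int_0^t |S n - H|^2 ds tends to 0 in probability. *)
Definition is_ito_integral (d : measure_display) (T : measurableType d)
    (R : realType) (P : probability T R) (F : R -> set (set T))
    (B H : R -> T -> R) (t : R) (I : T -> R) :=
  exists S : nat -> step_process T R,
    [/\ forall n, adapted_step F t (S n),
        cvg_in_probability0 P (fun n w =>
          \int[lebesgue_measure]_(s in `[0%R, t])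
             ((step_value (S n) s w - H s w) ^+ 2)%:E)%E
      & cvg_in_probability0 P (fun n w =>
          (`|step_integral B (S n) w - I w|)%:E)].

(* dX_t = mu(X_t) dt + sigma(X_t) dB_t, X_0 = x *)
Definition strong_solution (d : measure_display) (T : measurableType d)
    (R : realType) (P : probability T R) (B : R -> T -> R)
    (mu sigma : R -> R) (x : R) (X : R -> T -> R) :=
  let F := completed_natural_filtration P B in
  [/\ forall t : R, 0 <= t -> measurable_wrt (F t) (X t),
      {ae P, forall w, {within `[0, +oo[, continuous (fun t => X t w)}},
      {ae P, forall w, X 0 w = x}
    & forall t : R, 0 <= t ->
        is_ito_integral P F B (fun s w => sigma (X s w)) t
          (fun w => X t w - x
             - Rintegral lebesgue_measure `[0, t] (fun s => mu (X s w)))].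

Definition unique_strong_solution (d : measure_display)
    (T : measurableType d) (R : realType) (P : probability T R)
    (B : R -> T -> R) (mu sigma : R -> R) (x : R) (X : R -> T -> R) :=
  strong_solution P B mu sigma x X /\
  forall Y, strong_solution P B mu sigma x Y ->
    {ae P, forall w, forall t : R, 0 <= t -> Y t w = X t w}.

(* F-stopping times with values in [0, c] *)
Definition stopping_times (T : Type) (R : realType) (F : R -> set (set T))
    (c : R) : set (T -> R) :=
  [set tau | (forall w, 0 <= tau w <= c) /\
             forall s : R, 0 <= s -> F s [set w | tau w <= s]].

(* [X x] is the diffusion started from [x], so that E_x[G(X_tau)] is the
   expectation of G(X x tau) under [P]. *)
Definition expected_gain (d : measure_display) (T : measurableType d)
    (R : realType) (P : probability T R) (X : R -> R -> T -> R) (G : R -> R)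
    (x : R) (tau : T -> R) : \bar R :=
  ('E_P[fun w => G (X x (tau w) w)])%E.

Definition value (d : measure_display) (T : measurableType d)
    (R : realType) (P : probability T R) (F : R -> set (set T))
    (X : R -> R -> T -> R) (G : R -> R) (horizon t x : R) : \bar R :=
  ereal_sup [set expected_gain P X G x tau
            | tau in stopping_times F (horizon - t)].

(* V is only defined up to the horizon, so the infimum is taken over
   s <= horizon - t; s = horizon - t always qualifies since
   V(horizon, .) = G. *)
Definition first_stopping_time (T : Type) (R : realType)
    (X : R -> R -> T -> R) (G : R -> R) (V : R -> R -> R)
    (horizon t x : R) (w : T) : R :=
  Num.min (inf [set s : R | 0 <= s <= horizon - t /\
                        V (t + s) (X x s w) = G (X x s w)])
          (horizon - t).

Definition continuation_set (R : realType) (horizon : R) (V : R -> R -> R)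
    (G : R -> R) : set (R * R) :=
  [set p | 0 <= p.1 <= horizon /\ V p.1 p.2 > G p.2].

Definition stopping_set (R : realType) (horizon : R) (V : R -> R -> R)
    (G : R -> R) : set (R * R) :=
  [set p | 0 <= p.1 <= horizon /\ V p.1 p.2 = G p.2].

Definition open_in (S : topologicalType) (E A : set S) :=
  exists2 O, open O & A = O `&` E.

Definition closed_in (S : topologicalType) (E A : set S) :=
  exists2 K, closed K & A = K `&` E.

(* On each bounded interval there are finitely many break points; no
   condition is imposed on the derivatives at these points. *)
Definition piecewise_C (R : realType) (k : nat) (f : R -> R) :=
  exists N : set R,
    (forall a c : R, finite_set (N `&` `[a, c])) /\
    forall x : R, ~ N x ->
      (forall i, (i < k)%N -> derivable (derive1n i f) x 1) /\
      {for x, continuous (derive1n k f)}.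

Definition upper_semicontinuous (R : realType) (f : R -> R) :=
  forall x a : R, f x < a -> \forall y \near x, f y < a.

(* [f] has the partial derivatives [ft], [fx], [fxx] in the open set [U],
   and the four functions are continuous on [K]. *)
Definition C12_with (R : realType) (U K : set (R * R)) (f : R -> R -> R)
    (ft fx fxx : R * R -> R) :=
  [/\ [/\ {within K, continuous (fun p => f p.1 p.2)},
          {within K, continuous ft},
          {within K, continuous fx}
        & {within K, continuous fxx}]
    & forall t x : R, U (t, x) ->
        [/\ is_derive t 1 (fun s => f s x) (ft (t, x)),
            is_derive x 1 (f t) (fx (t, x))
          & is_derive x 1 (fun y => fx (t, y)) (fxx (t, x))]].

(* C^{1,2} inside A *)
Definition C12_inside (R : realType) (A : set (R * R)) :=
  @C12_with R A° A°.

(* C^{1,2} of the closure of A: the derivatives inside A extend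
   continuously to the closure, and [ft], [fx], [fxx] are the extensions. *)
Definition C12_closure (R : realType) (A : set (R * R)) :=
  @C12_with R A° (closure A).

(* L_X f (x), as a function of x and of the values f'(x) and f''(x) *)
Definition generator (R : realType) (mu sigma : R -> R)
    (x f'x f''x : R) : R :=
  sigma x ^+ 2 / 2 * f''x + mu x * f'x.

Definition disk (R : realType) (t x e : R) : set (R * R) :=
  [set p | (p.1 - t) ^+ 2 + (p.2 - x) ^+ 2 < e ^+ 2].

(* The sets C and D determine b(t) for t < horizon only; at the horizon the
   boundary takes the value b(horizon-), which may be infinite. *)
Definition boundary (R : realType) (horizon : R) (b : R -> R) (t : R)
    : \bar R :=
  if t < horizon then (b t)%:E
  else lim ((b s)%:E @[s --> horizon^'-]).

(* Main.v *)
Require Import Defs.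
From mathcomp Require Import ring lra.

(* Since [G] does not depend on time, [V] is nonincreasing in [t], hence [b] is
   nondecreasing; as the continuation set is open, [b] is also upper
   semicontinuous, i.e. right-continuous. For left-continuity, suppose that
   [b] jumps at [t]. For [s < t] the slice [V(s, .)] satisfies
   [L_X V = - V_t >= 0] over the jump, while [L_X G <= - l], so [V(s, .) - G] is
   a strict subsolution of [L_X]. A one-dimensional maximum principle, applied
   slice by slice, bounds it away from 0 at an endpoint of a fixed interval,
   contradicting [V(s, .) --> V(t, .) = G] as [s] increases to [t]. *)

Local Open Scope classical_set_scope.
Local Open Scope ring_scope.

(** * One-dimensional maximum principle *)

Lemma is_derive_gt0_right (R : realType) (g : R -> R) (c b dg : R) :
  c < b -> is_derive c 1 g dg -> 0 < dg ->
  exists2 y, c < y <= b & forall z, c < z <= y -> g c < g z.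
Proof.
move=> cb [/cvg_ex[/= l gl] Dg] dg0.
have {Dg} El : l = dg by rewrite -Dg; apply/esym/cvg_lim.
rewrite {}El in gl.
have : \forall h \near 0^', 0 < h^-1 *: (g (h *: 1 + c) - g c).
  exact: (cvgr_gt _ gl).
move=> /nbhs_ballP[r /= r0 br].
exists (Num.min (c + r / 2) b) => [|z].
  by rewrite lt_min cb ge_min lexx orbT !andbT; lra.
rewrite le_min => /and3P[cz zr _].
have zcr : ball 0 r (z - c) by rewrite /ball/= sub0r normrN gtr0_norm; lra.
have zc0 : z - c != 0 by rewrite subr_eq0 gt_eqF.
have := br _ zcr zc0; rewrite /= scaler1 subrK.
by rewrite /GRing.scale/= pmulr_rgt0 ?invr_gt0 ?subr_gt0.
Qed.

(** At an interior maximum the first-order term vanishes, so the strict inequality forces [w2 > 0]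
    there even though [A] may be zero elsewhere; this is incompatible with a maximum. No continuity
    of [w2] is required. *)
Lemma maximum_principle (R : realType) (w w1 w2 A M : R -> R) (a b : R) :
  a <= b ->
  (forall x, a <= x <= b ->
    [/\ is_derive x 1 w (w1 x), is_derive x 1 w1 (w2 x), 0 <= A x
      & 0 < A x * w2 x + M x * w1 x]) ->
  forall x, a <= x <= b -> w x <= Num.max (w a) (w b).
Proof.
move=> ab H x xab.
have cw : {within `[a, b], continuous w}.
  apply: derivable_within_continuous => z; rewrite in_itv/= => zab.
  by have [[]] := H _ zab.
have [c] := EVT_max ab cw; rewrite in_itv/= => cab cmax.
have {cmax} maxc z : a <= z <= b -> w z <= w c.
  by move=> zab; apply: cmax; rewrite in_itv.
have wxc := maxc _ xab; rewrite le_max.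
have [eca|nca] := eqVneq c a; first by rewrite -eca wxc.
have [ecb|ncb] := eqVneq c b; first by rewrite -ecb wxc orbT.
case/andP: cab => ac cb.
have {nca}ac : a < c by rewrite lt_neqAle eq_sym nca.
have {ncb}cb : c < b by rewrite lt_neqAle ncb.
have /H[wc w1c A0] : a <= c <= b by rewrite !ltW.
have dc0 : is_derive c 1 w 0.
  apply: (@derive1_at_max _ w a b c ab) => [t||t]; rewrite ?in_itv/= ?ac//.
    by move=> /andP[/ltW at_ /ltW tb]; have [[]] := H t (introT andP (conj at_ tb)).
  by move=> /andP[/ltW at_ /ltW tb]; apply: maxc; rewrite at_.
have w1c0 : w1 c = 0 by rewrite -(@derive_val _ _ _ _ _ _ _ wc) derive_val.
rewrite w1c0 mulr0 addr0 => Aw2.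
have w2c : 0 < w2 c.
  by rewrite ltNge; apply/negP => w20; move: Aw2; rewrite ltNge mulr_ge0_le0.
(* In place of a second-derivative test: [w1] is positive just to the right of [c], so the mean
   value theorem makes [w y] exceed the maximum [w c]. *)
have [y /andP[cy yb] yw1] := is_derive_gt0_right _ _ _ _ _ cb w1c w2c.
have sub z : c <= z <= y -> a <= z <= b by lra.
have [z] : exists2 z, z \in `]c, y[%R & w y - w c = w1 z * (y - c).
  apply: MVT => // [z|].
    rewrite in_itv/= => /andP[/ltW cz /ltW zy].
    by have [] := H z (sub _ (introT andP (conj cz zy))).
  apply: derivable_within_continuous => z; rewrite in_itv/= => /sub zab.
  by have [[]] := H _ zab.
rewrite in_itv/= => /andP[cz zy] E.
have : w1 c < w1 z by apply: yw1; lra.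
rewrite w1c0 => w1z.
have wyc : w y <= w c by apply: maxc; lra.
have : 0 < w1 z * (y - c) by rewrite mulr_gt0// subr_gt0.
by rewrite -E subr_gt0 ltNge wyc.
Qed.

(* Comparison with the parabola c (x - m)^2. *)
Lemma strict_subsolution_drop (R : realType) (f f1 f2 A M : R -> R)
    (m h c : R) :
  0 < h ->
  (forall x, m - h <= x <= m + h ->
    [/\ is_derive x 1 f (f1 x), is_derive x 1 f1 (f2 x), 0 <= A x
      & c * (2 * A x + 2 * M x * (x - m)) < A x * f2 x + M x * f1 x]) ->
  f m <= Num.max (f (m - h)) (f (m + h)) - c * h ^+ 2.
Proof.
move=> h0 H.
(* The parabola vanishes at [m] and equals [c * h ^+ 2] at both endpoints; the hypothesis says that
   the operator is positive on [w]. *)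
pose w x := f x - c * (x - m) ^+ 2.
have wE : w = f \- c *: (id \- cst m) ^+ 2 :> (R -> R) by apply/funext => x.
have /(maximum_principle _ w _ _ A M) : forall x, m - h <= x <= m + h ->
    [/\ is_derive x 1 w (f1 x - c * (2 * (x - m))),
        is_derive x 1 (fun x => f1 x - c * (2 * (x - m))) (f2 x - c * 2),
        0 <= A x
      & 0 < A x * (f2 x - c * 2) + M x * (f1 x - c * (2 * (x - m)))].
  move=> x /H[df df1 A0 ineq]; split => //; last by lra.
    rewrite wE; apply: is_derive_eq; rewrite /GRing.scale/= /cst; ring.
  have -> : (fun x => f1 x - c * (2 * (x - m))) =
      f1 \- c *: (2 *: (id \- cst m)) :> (R -> R) by apply/funext.
  by apply: is_derive_eq; rewrite /GRing.scale/= /cst; ring.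
move=> /(_ ltac:(lra)) /(_ m ltac:(lra)).
rewrite /w subrr expr0n/= mulr0 subr0 => /le_trans; apply.
have -> : m - h - m = - h by ring.
have -> : m + h - m = h by ring.
by rewrite sqrrN ge_max !lerB// le_max lexx ?orbT.
Qed.

(** * Local bounds on the coefficients, and monotonicity of the value in time *)

Lemma cvg_pair_cstr (R : realType) (t x : R) : (s, x) @[s --> t] --> (t, x).
Proof. exact: (cvg_pair cvg_id (cvg_cst x)). Qed.

Lemma locally_lipschitz_near_bounded (R : realType) (f : R -> R) (m : R) :
  [locally [lipschitz f x | x in setT]] ->
  exists2 K : R, 0 <= K & \forall y \near m, `|f y| <= K.
Proof.
(* The local Lipschitz property holds near [(m, m)] for every constant above some [M0]; [|M0| + 1]
   is such a constant and is positive. Freezing one argument at [m] then bounds [f]. *)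
move=> /(_ (m, m) (conj I I))[M0 [M0r /(_ (`|M0| + 1))]].
have /[swap]/[apply] : M0 < `|M0| + 1 by have := ler_norm M0; lra.
move=> lip0.
have lipf : \forall p \near (m, m),
    `|f p.1 - f p.2| <= (`|M0| + 1) * `|p.1 - p.2|.
  have : nbhs (m, m) [set p : R * R | (setT `*` setT) p ->
    `|f p.1 - f p.2| <= (`|M0| + 1) * `|p.1 - p.2| ] := lip0.
  by apply: filterS => p /(_ (conj I I)).
exists (`|f m| + (`|M0| + 1)).
  by have := normr_ge0 (f m); have := normr_ge0 M0; lra.
have near1 : \forall y \near m, `|y - m| <= 1.
  by near=> y; rewrite distrC; near: y; exact: cvgr_dist_le.
near=> y.
have ym : `|f y - f m| <= (`|M0| + 1) * `|y - m|.
  by near: y; exact: cvg_pair_cstr lipf.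
have : (`|M0| + 1) * `|y - m| <= `|M0| + 1.
  by rewrite ler_piMr//; near: y.
have := ler_normD (f y - f m) (f m); rewrite subrK.
by lra.
Unshelve. all: by end_near. Qed.


(** A later start leaves fewer stopping times, while the gain of each of them does not depend on the
    start time. *)
Lemma le_value (R : realType) (d : measure_display) (Omega : measurableType d)
    (P : probability Omega R) (F : R -> set (set Omega))
    (X : R -> R -> Omega -> R) (G : R -> R) (T s t x : R) :
  s <= t -> (value P F X G T t x <= value P F X G T s x)%E.
Proof.
move=> st; apply: le_ereal_sup => _ [tau [tau0 tauF] <-].
exists tau => //; split => // w.
by have /andP[-> /le_trans] := tau0 w; apply; rewrite lerB.
Qed.

(** * Continuity of a monotone boundary up to the horizon *)

(** The reflection [s |-> - s] reduces this to the right limit of a nonincreasing function. *)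
Lemma nondecreasing_at_left_cvge (R : realType) (f : R -> \bar R) (a r : R) :
  a < r -> {in `[a, r[ &, {homo f : s t / s <= t >-> (s <= t)%E}} ->
  f s @[s --> r^'-] --> ereal_sup (f @` `[a, r[).
Proof.
move=> ar fhomo; apply/cvg_at_leftNP.
have : (BRight (- r) < BRight (- a))%O by rewrite bnd_simp; lra.
move=> /(@nonincreasing_at_right_cvge _ (f \o -%R)).
have -> : (f \o -%R) @` `](- r), (- a)] = f @` `[a, r[.
  apply/seteqP; split => _ [s /= +] <-; rewrite in_itv/= => sI.
    by exists (- s) => //=; rewrite in_itv/=; lra.
  by exists (- s); rewrite /= ?opprK// in_itv/=; lra.
apply=> s t; rewrite !in_itv/= => sI tI ts.
by apply: fhomo; rewrite ?in_itv/=; lra.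
Qed.

(** Isolates the order-theoretic part: upper semicontinuity excludes jumps to the right of [t], and
    the last hypothesis, that earlier values come arbitrarily close to [b t], excludes jumps to its
    left. *)
Lemma boundary_homo_continuous (R : realType) (T : R) (b : R -> R) :
  0 < T ->
  (forall s t : R, 0 <= s -> s <= t -> t < T -> b s <= b t) ->
  (forall t y : R, 0 <= t < T -> b t < y ->
    \forall s \near t, 0 <= s < T -> b s < y) ->
  (forall t y : R, 0 < t < T -> y < b t -> exists2 s : R, 0 <= s < t & y < b s) ->
  {in `[0, T] &, {homo boundary T b : s t / s <= t >-> (s <= t)%E}} /\
  {within `[0, T], continuous (boundary T b)}.
Proof.
move=> T0 bhomo busc blsc.
have bT : (b s)%:E @[s --> T^'-] --> ereal_sup [set (b s)%:E | s in `[0, T[].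
  apply: nondecreasing_at_left_cvge => // s t; rewrite !in_itv/= => sI tI st.
  by rewrite lee_fin bhomo//; lra.
have bTE : boundary T b T = ereal_sup [set (b s)%:E | s in `[0, T[].
  by rewrite /boundary ltxx; apply: cvg_lim.
split=> [s t|].
  rewrite !in_itv/= => /andP[s0 sT] /andP[t0 tT] st.
  move: tT; rewrite le_eqVlt => /predU1P[->|tT]; last first.
    by rewrite /boundary tT (le_lt_trans st tT) lee_fin bhomo.
  move: sT; rewrite le_eqVlt => /predU1P[->//|sT].
  rewrite bTE /boundary sT; apply: ereal_sup_ubound.
  by exists s => //=; rewrite in_itv/= s0.
apply/subspace_continuousP => t; rewrite /from_subspace /= in_itv/= => /andP[t0].
(* At the horizon the boundary is its own left limit, which exists by monotonicity. *)
rewrite le_eqVlt => /predU1P[->{t t0}|tT].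
  rewrite bTE => A nA.
  have bA : nbhs T [set s | s < T -> A (b s)%:E] := bT _ nA.
  suff : nbhs T [set s | `[0, T]%classic s -> A (boundary T b s)] by [].
  apply: filterS bA => s /= sA; rewrite in_itv/= => /andP[s0].
  rewrite le_eqVlt => /predU1P[->|sT]; first by rewrite bTE; exact: nbhs_singleton.
  by rewrite /boundary sT; exact: sA.
rewrite {2}/boundary tT.
have bt : b s @[s --> within `[0, T] (nbhs t)] --> b t.
  apply/cvgrPdist_lt => e e0; rewrite near_withinE.
  have tT' : \forall s \near t, s < T by exact: lt_nbhsl.
  have ub := busc t (b t + e) ltac:(lra) ltac:(lra).
  have lb : \forall s \near t, 0 <= s < T -> b t - e < b s.
    (* At [t = 0] nothing lies to the left in the interval, so monotonicity alone gives the lower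
       bound; for [t > 0] an earlier [r] with [b r > b t - e] bounds all later values. *)
    move: t0; rewrite le_eqVlt => /predU1P[t0|t0].
      near=> s => /andP[s0 sT].
      have := bhomo t s ltac:(lra) ltac:(lra) sT; lra.
    have [r /andP[r0 rt] br] := blsc t (b t - e) ltac:(lra) ltac:(lra).
    have rt' : \forall s \near t, r < s by exact: lt_nbhsr.
    apply: filterS rt' => s rs /andP[s0 sT].
    by have := bhomo r s r0 ltac:(lra) sT; lra.
  near=> s; rewrite /= in_itv/= => /andP[s0 _].
  have sT : 0 <= s < T by rewrite s0; near: s.
  have h1 : b s < b t + e by move: sT; near: s.
  have h2 : b t - e < b s by move: sT; near: s.
  by rewrite ltr_norml; lra.
have : (b s)%:E @[s --> within `[0, T] (nbhs t)] --> (b t)%:E.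
  by apply: cvg_EFin => //; exact: nearW.
apply: cvg_trans; apply: near_eq_cvg; rewrite near_withinE.
have : \forall s \near t, s < T by exact: lt_nbhsl.
by apply: filterS => s sT _; rewrite /boundary sT.
Unshelve. all: by end_near. Qed.


(** * Left-continuity of the boundary *)

Lemma open_disk (R : realType) (t x e : R) : open (disk t x e).
Proof.
have -> : disk t x e =
    (fun p : R * R => (p.1 - t) ^+ 2 + (p.2 - x) ^+ 2) @^-1` [set u | u < e ^+ 2].
  by [].
apply: open_comp; last exact: open_lt.
move=> p _; apply: cvgD; apply: cvgM; apply: cvgB;
  by [exact: cvg_fst|exact: cvg_snd|exact: cvg_cst].
Qed.

Lemma is_derive_nonincreasing (R : realType) (f : R -> R) (t df a : R) :
  t < a -> (forall s, t <= s <= a -> f s <= f t) -> is_derive t 1 f df ->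
  df <= 0.
Proof.
move=> ta ft dft; rewrite leNgt; apply/negP => df0.
have [y tya yf] := is_derive_gt0_right _ _ _ _ _ ta dft df0.
by have := yf y ltac:(lra); have := ft y ltac:(lra); lra.
Qed.

Lemma nbhs_strip (R : realType) (T t x : R) :
  0 < t < T -> nbhs (t, x) (`]0, T[ `*` [set: R]).
Proof.
move=> tT; exists (`]0, T[%classic, setT) => //.
split; last exact: filterT.
by apply: open_nbhs_nbhs; split; [exact: interval_open|rewrite /= in_itv].
Qed.

(** Relative openness becomes openness at times strictly between [0] and [T], which gives access to
    the derivatives of [V], available only in the interior. *)
Lemma nbhs_open_in_strip (R : realType) (T t x : R) (C : set (R * R)) :
  open_in (`[0, T] `*` [set: R]) C -> C (t, x) -> 0 < t < T ->
  nbhs (t, x) C.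
Proof.
move=> [U oU ->] [Utx _] tT; apply: filterI; first exact: open_nbhs_nbhs.
apply: filterS (nbhs_strip _ _ _ x tT) => p [p1 _].
by split => //; apply: subset_itv_oo_cc p1.
Qed.

Lemma boundary_left_approx (R : realType) (mu sigma : R -> R) (T : R)
    (G : R -> R) (V : R -> R -> R) (b : R -> R) :
  (forall s t x : R, 0 <= s -> s <= t -> t <= T -> V t x <= V s x) ->
  open_in (`[0, T] `*` [set: R]) (continuation_set T V G) ->
  (exists Vt Vx Vxx : R * R -> R,
    C12_inside (continuation_set T V G) V Vt Vx Vxx /\
    forall p : R * R, (continuation_set T V G)° p ->
      Vt p + generator mu sigma p.2 (Vx p) (Vxx p) = 0) ->
  [locally [lipschitz mu x | x in setT]] ->
  [locally [lipschitz sigma x | x in setT]] ->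
  {within `]0, T[ `*` [set: R], continuous (fun p : R * R => V p.1 p.2)} ->
  continuation_set T V G = [set p : R * R | 0 <= p.1 < T /\ p.2 > b p.1] ->
  (forall t x : R, 0 <= t < T -> x <= b t -> V t x = G x) ->
  (forall t : R, 0 <= t < T ->
    exists eps : R, 0 < eps /\
    exists Gt Gx Gxx : R * R -> R,
      C12_closure (disk t (b t) eps `&` continuation_set T V G)
        (fun _ x => G x) Gt Gx Gxx /\
      exists2 l : R, 0 < l &
        forall p : R * R,
          closure (disk t (b t) eps `&` continuation_set T V G) p ->
          Gt p + generator mu sigma p.2 (Gx p) (Gxx p) <= - l) ->
  forall t y : R, 0 < t < T -> y < b t -> exists2 s : R, 0 <= s < t & y < b s.
Proof.
move=> Vhomo C_open [Vt [Vx [Vxx [[_ dV] pde]]]] lip_mu lip_sigma V_cont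
  C_b VG G_gen t y /andP[t0 tT] ybt.
have [//|/forall2NP nb] := pselect (exists2 s : R, 0 <= s < t & y < b s).
have {nb} bs_le s : 0 <= s < t -> b s <= y.
  by move=> st; case: (nb s) => [//|/negP]; rewrite -leNgt.
have [e [e0 [Gt [Gx [Gxx [[_ dG] [l l0 LG]]]]]]] := G_gen t ltac:(lra).
(* With the space distance to [b t] below [e / 2], and later the time distance too, points stay in
   the disk of radius [e]. *)
pose lo := Num.max y (b t - e / 2).
have ylo : y <= lo by rewrite le_max lexx.
have elo : b t - e / 2 <= lo by rewrite le_max lexx orbT.
have lob : lo < b t by rewrite gt_max ybt; lra.
pose m := (lo + b t) / 2.
have lom : lo < m by rewrite /m; lra.
have mb : m < b t by rewrite /m; lra.
have [K1 K10 mu_le] := locally_lipschitz_near_bounded _ _ m lip_mu.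
have [K2 K20 sigma_le] := locally_lipschitz_near_bounded _ _ m lip_sigma.
(* Half of the radius is taken so that the closed interval around [m] fits in the open ball. *)
have [h h0 Hh] : exists2 h : R, 0 < h & forall x : R, m - h <= x <= m + h ->
    [/\ `|mu x| <= K1, `|sigma x| <= K2, lo < x, x < b t & `|x - m| <= 1].
  have : \forall x \near m,
      [/\ `|mu x| <= K1, `|sigma x| <= K2, lo < x, x < b t & `|x - m| <= 1].
    near=> x; split; near: x.
    - exact: mu_le.
    - exact: sigma_le.
    - exact: lt_nbhsr.
    - exact: lt_nbhsl.
    - by near=> x; rewrite distrC; near: x; exact: cvgr_dist_le.
  move=> /nbhs_ballP[r /= r0 Hr]; exists (r / 2) => [|x xr]; first by lra.
  by apply: Hr; rewrite /ball/= ltr_norml; lra.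
(* [K] strictly dominates the generator applied to [(x - m) ^+ 2] on the interval; the term [1]
   provides the strictness and makes [K] positive. Hence [c] times this quantity stays below [l]. *)
pose K := K2 ^+ 2 + 2 * K1 + 1.
have K0 : 0 < K by rewrite /K; have := sqr_ge0 K2; lra.
pose c := l / K.
have c0 : 0 < c by rewrite divr_gt0.
have cK : c * K = l by rewrite /c divfK ?gt_eqF.
have inC s x : 0 < s < t -> m - h <= x <= m + h ->
    continuation_set T V G (s, x).
  move=> st /Hh[_ _ lox _ _]; rewrite C_b; split => /=; first by lra.
  by have := bs_le s ltac:(lra); lra.
have drop s : 0 < s < t -> t - s < e / 2 ->
    V s m - G m <=
      Num.max (V s (m - h) - G (m - h)) (V s (m + h) - G (m + h)) - c * h ^+ 2.
  move=> st ts.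
  apply: (strict_subsolution_drop _ (fun x => V s x - G x)
    (fun x => Vx (s, x) - Gx (s, x)) (fun x => Vxx (s, x) - Gxx (s, x))
    (fun x => sigma x ^+ 2 / 2) mu _ _ _ h0) => x xm.
  have Csx := inC _ _ st xm.
  have Isx := nbhs_open_in_strip _ _ _ _ _ C_open Csx ltac:(lra).
  have [mux sigx lox xb xm1] := Hh _ xm.
  have Dsx : disk t (b t) e (s, x).
    by rewrite /disk/=; nra.
  have IDsx : nbhs (s, x) (disk t (b t) e `&` continuation_set T V G).
    by apply: filterI => //; apply: open_nbhs_nbhs; split => //; exact: open_disk.
  have [dVt dVx dVxx] := dV _ _ Isx.
  have [dGt dGx dGxx] := dG _ _ IDsx.
  have Vt0 : Vt (s, x) <= 0.
    apply: (@is_derive_nonincreasing _ (fun s => V s x) s _ T _ _ dVt).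
      by lra.
    by move=> r rs; apply: Vhomo; lra.
  have Gt0 : Gt (s, x) = 0.
    by rewrite -(@derive_val _ _ _ _ _ _ _ dGt) derive_cst.
  (* Since [Vt <= 0] and [Gt = 0], the generator is at least [0] on [V] and at most [- l] on [G],
     hence at least [l] on the difference. *)
  have := pde _ Isx; have := LG (s, x) (@subset_closure _ _ _ (conj Dsx Csx)).
  rewrite Gt0 /generator /= => LGx pdex; split.
  - exact: is_deriveB.
  - exact: is_deriveB.
  - by rewrite divr_ge0// sqr_ge0.
  have sig2 : sigma x ^+ 2 <= K2 ^+ 2.
    by rewrite -real_normK ?num_real// ler_sqr ?nnegrE.
  have muxm : mu x * (x - m) <= K1.
    apply: (le_trans (ler_norm _)); rewrite normrM -[leRHS]mulr1.
    exact: ler_pM.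
  have : c * (2 * (sigma x ^+ 2 / 2) + 2 * mu x * (x - m)) < l.
    by rewrite -cK ltr_pM2l// /K; lra.
  lra.
(* The whole interval lies below [b t], so [V] equals [G] there at time [t]. *)
have V_cvg x : m - h <= x <= m + h -> V s x - G x @[s --> t] --> 0.
  move=> /Hh[_ _ _ xb _].
  have -> : 0 = V t x - G x by rewrite VG ?subrr//; lra.
  apply: cvgB; last exact: cvg_cst.
  have Vtx : {for (t, x), continuous (fun p : R * R => V p.1 p.2)}.
    have tT' : 0 < t < T by rewrite t0.
    move/subspace_continuousP: V_cont => /(_ (t, x)).
    rewrite /from_subspace within_interior; last exact: nbhs_strip.
    by apply; exact: nbhs_singleton (nbhs_strip _ _ _ x tT').
  exact: (cvg_comp _ _ (cvg_pair_cstr _ t x) Vtx).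
have ch0 : 0 < c * h ^+ 2 by rewrite mulr_gt0// exprn_gt0.
(* Close to [t] both endpoint excesses fall below [c * h ^+ 2]; [drop] then gives [V s m < G m],
   although [(s, m)] is in the continuation set. *)
have [s [st ts Vl Vr]] : exists s, [/\ 0 < s < t, t - s < e / 2,
    V s (m - h) - G (m - h) < c * h ^+ 2 & V s (m + h) - G (m + h) < c * h ^+ 2].
  near t^'- => s; exists s; split.
  - apply/andP; split; near: s; last exact: nbhs_left_lt.
    exact: nbhs_left_gt.
  - rewrite ltrBlDr -ltrBlDl; near: s; apply: nbhs_left_gt; lra.
  - near: s; apply: (cvgr_lt _ (cvg_at_left_filter (V_cvg _ _))) => //; lra.
  - near: s; apply: (cvgr_lt _ (cvg_at_left_filter (V_cvg _ _))) => //; lra.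
have [_ /= VGm] := inC s m st ltac:(lra).
have := drop s st ts.
have : Num.max (V s (m - h) - G (m - h)) (V s (m + h) - G (m + h)) < c * h ^+ 2.
  by rewrite gt_max Vl.
lra.
Unshelve. all: by end_near. Qed.

(** * Monotonicity and right-continuity of the boundary, and the conclusion *)

Theorem proposition3p5 (R : realType)
  (d : measure_display) (Omega : measurableType d) (P : probability Omega R)
  (P_complete : measure_is_complete P)
  (B : R -> Omega -> R) (B_brownian : brownian_motion P B)
  (mu sigma : R -> R)
  (X : R -> R -> Omega -> R)
  (X_sde : forall x : R, unique_strong_solution P B mu sigma x (X x))
  (T : R) (T_gt0 : 0 < T)
  (G : R -> R)
  (V : R -> R -> R)
  (V_value : forall t x : R, 0 <= t <= T ->
    (V t x)%:E = value P (completed_natural_filtration P B) X G T t x)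
  (* standing assumptions *)
  (tau_star_optimal : forall t x : R, 0 <= t <= T ->
    stopping_times (completed_natural_filtration P B) (T - t)
      (first_stopping_time X G V T t x) /\
    expected_gain P X G x (first_stopping_time X G V T t x) = (V t x)%:E)
  (C_open : open_in (`[0, T] `*` [set: R]) (continuation_set T V G))
  (D_closed : closed_in (`[0, T] `*` [set: R]) (stopping_set T V G))
  (V_pde : exists Vt Vx Vxx : R * R -> R,
    C12_inside (continuation_set T V G) V Vt Vx Vxx /\
    forall p : R * R, (continuation_set T V G)° p ->
      Vt p + generator mu sigma p.2 (Vx p) (Vxx p) = 0)
  (* (i) *)
  (mu_lipschitz : [locally [lipschitz mu x | x in setT]])
  (sigma_lipschitz : [locally [lipschitz sigma x | x in setT]])
  (mu_C2 : piecewise_C 2 mu)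
  (sigma_gt0 : forall x, 0 < sigma x)
  (sigma_C3 : piecewise_C 3 sigma)
  (* (ii) *)
  (G_usc : upper_semicontinuous G)
  (* (iii) *)
  (V_continuous :
    {within `]0, T[ `*` [set: R], continuous (fun p : R * R => V p.1 p.2)})
  (* (iv) *)
  (b : R -> R)
  (C_boundary : continuation_set T V G =
    [set p : R * R | 0 <= p.1 < T /\ p.2 > b p.1])
  (D_boundary : stopping_set T V G =
    [set p : R * R | 0 <= p.1 < T /\ p.2 <= b p.1] `|` ([set T] `*` setT))
  (* (v) *)
  (G_C12 : forall t : R, 0 <= t < T ->
    exists eps : R, 0 < eps /\
    exists Gt Gx Gxx : R * R -> R,
      C12_closure (disk t (b t) eps `&` continuation_set T V G)
        (fun _ x => G x) Gt Gx Gxx)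
  (* (vi) *)
  (G_generator : forall t : R, 0 <= t < T ->
    exists eps : R, 0 < eps /\
    exists Gt Gx Gxx : R * R -> R,
      C12_closure (disk t (b t) eps `&` continuation_set T V G)
        (fun _ x => G x) Gt Gx Gxx /\
      exists2 l : R, 0 < l &
        forall p : R * R, closure (disk t (b t) eps `&` continuation_set T V G) p ->
          Gt p + generator mu sigma p.2 (Gx p) (Gxx p) <= - l) :
  {in `[0, T] &, {homo boundary T b : s t / s <= t >-> (s <= t)%E}} /\
  {within `[0, T], continuous (boundary T b)}.
Proof.
have Vhomo (s t x : R) : 0 <= s -> s <= t -> t <= T -> V t x <= V s x.
  move=> s0 st tT; rewrite -lee_fin !V_value; [|lra..].
  exact: le_value.
have inC (t x : R) : 0 <= t < T -> b t < x -> G x < V t x.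
  move=> tT bx; suff [] : continuation_set T V G (t, x) by [].
  by rewrite C_boundary.
have inD (t x : R) : 0 <= t < T -> x <= b t -> V t x = G x.
  move=> tT xb; suff [] : stopping_set T V G (t, x) by [].
  by rewrite D_boundary; left.
apply: boundary_homo_continuous => //.
(* If [b t < b s], the point [b s] continues at time [t] but stops at the earlier time [s], so
   [V s (b s) = G (b s) < V t (b s)], against [Vhomo]. *)
- move=> s t s0 st tT; rewrite leNgt; apply/negP => bts.
  have := inC t (b s) ltac:(lra) bts.
  rewrite -(inD s) ?lexx ?s0 ?(le_lt_trans st)//.
  by rewrite ltNge Vhomo// ltW.
(* Openness of the continuation set at [(t, y)], moved along the time axis with [y] fixed. *)
- move=> t y tT bty.
  have [U oU CU] := C_open.
  have [Uty _] : (U `&` (`[0, T] `*` setT)) (t, y) by rewrite -CU C_boundary.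
  have nU : \forall s \near t, U (s, y).
    by apply: cvg_pair_cstr; exact: open_nbhs_nbhs.
  apply: filterS nU => s Usy sT.
  suff : continuation_set T V G (s, y) by rewrite C_boundary => -[].
  by rewrite CU; split => //; split => //=; rewrite in_itv/=; lra.
- exact: (boundary_left_approx _ mu sigma T G V).
Qed.
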